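(* Let $0\le p\le 1/2$ and let $(\mathbf H_t)_{t\in\mathbb N}$ be a sequence of stabilizer matrices, defining stabilizer codes of rates $R_t$. Suppose that $R_t$ converges to $R$ and that the decoding error probability $P_{err}$ of the codes over the quantum erasure channel of erasure probability $p$ tends to $0$ as $t\to\infty$ (that is, $R$ is an achievable rate for the sequence). Then $$R\le 1-2p.$$
   Context: Pauli group: $\mathcal P_n$ is the group of $n$-fold tensor products of $I,X,Y,Z$ taken modulo phases $\{\pm1,\pm i\}$; it is identified with $\mathbb F_2^{2n}$ by $X_i\mapsto(e_i|0)$, $Z_i\mapsto(0|e_i)$, $Y_i\mapsto (e_i|e_i)$, so that multiplication becomes addition. Two elements commute or anti-commute (as operators); $E,E'$ anti-commute iff the number of positions $j$ where $E_j,E'_j$ are distinct and both different from $I$ is odd. A stabilizer matrix $\mathbf H$ is an $r\times n$ matrix with entries in $\{I,X,Y,Z\}$ whose rows (elements of $\mathcal P_n$) pairwise commute. It generates the stabilizer group $S\subset\mathcal P_n$. $\operatorname{rank}\mathbf H$ is the $\mathbb F_2$-dimension of the span of the rows. The associated stabilizer code has length $n$, encodes $k=n-\operatorname{rank}\mathbf H$ qubits, and has rate $R=k/n$. The syndrome of $E\in\mathcal P_n$ is $\sigma(E)\in\mathbb F_2^r$, whose $i$-th coordinate is $0$ if $E$ commutes with the $i$-th row and $1$ otherwise. Quantum erasure channel of probability $p$: the erasure $\mathcal E\in\mathbb F_2^n$ is random with i.i.d. Bernoulli($p$) coordinates; given $\mathcal E$, the error $E$ is uniform among Pauli operators $E\in\mathcal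 P_n$ with $E_i=I$ whenever $\mathcal E_i=0$. The decoder sees $(\mathcal E,\sigma(E))$ and must determine the coset $E\cdot S\in \mathcal P_n/S$. $P_{err}$ is the probability that the best possible estimate $\hat X$ of $X=E\cdot S$, as a function of $(\mathcal E,\sigma(E))$, differs from $X$. *)

(* Defs.v *)
From HB Require Import structures.
From mathcomp Require Import all_boot all_order all_algebra all_fingroup.
From mathcomp Require Import all_classical all_reals all_analysis.

Set Implicit Arguments.
Unset Strict Implicit.
Unset Printing Implicit Defensive.

Import Order.TTheory GRing.Theory Num.Theory.
Import numFieldNormedType.Exports.

Local Open Scope ring_scope.

(* Single-qubit Pauli operators modulo phases. *)
Inductive pauli : Type := PI | PX | PY | PZ.

(* X |-> (1|0), Z |-> (0|1), Y |-> (1|1) *)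
Definition pauli_bits (a : pauli) : 'F_2 * 'F_2 :=
  match a with
  | PI => (0, 0)
  | PX => (1, 0)
  | PY => (1, 1)
  | PZ => (0, 1)
  end.

Definition bits_pauli (v : 'F_2 * 'F_2) : pauli :=
  if v.1 == 0 then (if v.2 == 0 then PI else PZ)
  else (if v.2 == 0 then PX else PY).

Lemma pauli_bitsK : cancel pauli_bits bits_pauli.
Proof. by case. Qed.

Lemma bits_pauliK : cancel bits_pauli pauli_bits.
Proof.
have F2 (u : 'F_2) : u = 0 \/ u = 1.
  by case: u => [[|[|m]] Hm] //=; [left | right]; apply/val_inj.
by case=> u v; case: (F2 u) => ->; case: (F2 v) => ->.
Qed.

HB.instance Definition _ := Finite.copy pauli (can_type pauli_bitsK).

(* Multiplication of Pauli operators modulo phases, written additively; it is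
   transported from F_2^2, e.g. PX + PZ = PY and PX + PX = PI. *)
Definition pauli_add (a b : pauli) : pauli :=
  bits_pauli (pauli_bits a + pauli_bits b).

Lemma pauli_addA : associative pauli_add.
Proof. by move=> a b c; rewrite /pauli_add !bits_pauliK addrA. Qed.

Lemma pauli_addC : commutative pauli_add.
Proof. by move=> a b; rewrite /pauli_add addrC. Qed.

Lemma pauli_add0 : left_id PI pauli_add.
Proof. by move=> a; rewrite /pauli_add add0r pauli_bitsK. Qed.

Lemma pauli_addN : left_inverse PI id pauli_add.
Proof. by case. Qed.

HB.instance Definition _ :=
  GRing.isZmodule.Build pauli pauli_addA pauli_addC pauli_add0 pauli_addN.

(* As a finite abelian group, pauli_group n carries both the additive notation
   and, through finGroupType, the multiplicative one. *)
Notation pauli_group n := ('rV[pauli]_n).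

Section Stabilizer.
Variables r n : nat.
Implicit Types (H : 'M[pauli]_(r, n)) (E : pauli_group n).

Definition anticommute E E' : bool :=
  odd #|[set j : 'I_n | [&& E ord0 j != E' ord0 j,
                            E ord0 j != PI & E' ord0 j != PI]]|.

Definition is_stabilizer_matrix H : Prop :=
  forall i j : 'I_r, ~~ anticommute (row i H) (row j H).

Definition binary_mx H : 'M['F_2]_(r, n + n) :=
  row_mx (map_mx (fun a => (pauli_bits a).1) H)
         (map_mx (fun a => (pauli_bits a).2) H).

Definition stab_rank H : nat := \rank (binary_mx H).

Definition stab_group H : {group pauli_group n} := <<[set row i H | i : 'I_r]>>%G.

Definition syndrome H E : 'rV['F_2]_r :=
  \row_i (anticommute E (row i H))%:R.

End Stabilizer.

Section Channel.
Variables (R : realType) (r n : nat).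
Implicit Types (H : 'M[pauli]_(r, n)) (p : R) (eps : 'rV['F_2]_n) (E : pauli_group n).

(* n - rank is computed in R, so there is no truncated subtraction. *)
Definition rate H : R := (n%:R - (stab_rank H)%:R) / n%:R.

Definition erasure_pr p eps : R :=
  \prod_(i < n) (if eps ord0 i == 1 then p else 1 - p).

Definition erased_errors eps : {set pauli_group n} :=
  [set E : pauli_group n | [forall i, (eps ord0 i == 0) ==> (E ord0 i == PI)]].

Definition error_pr eps E : R :=
  if E \in erased_errors eps then (#|erased_errors eps|%:R)^-1 else 0.

(* The estimate ranges over the quotient group P_n / S. Since P_n is abelian,
   every E normalizes S, so coset (stab_group H) E really is E . S. *)
Definition decoder H := 'rV['F_2]_n -> 'rV['F_2]_r -> coset_of (stab_group H).

Definition decoding_error p H (D : decoder H) : R :=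
  \sum_(eps : 'rV['F_2]_n) \sum_(E : pauli_group n)
    erasure_pr p eps * error_pr eps E *
    (D eps (syndrome H E) != coset (stab_group H) E)%:R.

(* There are finitely many decoders, so the infimum is attained. *)
Definition P_err p H : R :=
  inf [set decoding_error p D | D in [set: decoder H]]%classic.

End Channel.

(* Main.v *)
Require Import Defs.
From HB Require Import structures.
From mathcomp Require Import all_boot all_order all_algebra all_fingroup.
From mathcomp Require Import all_classical all_reals all_analysis.
From mathcomp Require Import zify lra.
Import Order.TTheory GRing.Theory Num.Theory.
Import numFieldNormedType.Exports.
Local Open Scope classical_set_scope.
Local Open Scope ring_scope.

(* Call an erasure A bad if some error supported on A has zero syndrome without
   being a stabilizer. If A is bad, pairing errors that differ by such an operator
   shows that every decoder fails with probability at least 1/2 on A, so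
   P(bad) <= 2 P_err. If A and A' are disjoint and both good, rank-nullity applied
   to the syndrome map and to the restriction of the stabilizer gives
     2 |A| + dim S_{A'} <= rank H + dim S_A   (S_A : stabilizers supported on A)
   and symmetrically, hence |A| + |A'| <= rank H. Since p <= 1/2, two disjoint
   erasures with i.i.d. Bernoulli(p) marginals exist on the same probability space;
   taking expectations yields 2 p n <= rank H + 2 n P(bad), that is
   rate <= 1 - 2 p + 4 P_err for every single code. *)

Lemma mxrank_diag (F : fieldType) (n : nat) (u : 'rV[F]_n) :
  \rank (diag_mx u) = (\sum_(i < n) (u ord0 i != 0%R))%N.
Proof.
have le_rank (v : 'rV[F]_n) :
    (\rank (diag_mx v) <= \sum_(i < n) (v ord0 i != 0%R))%N.
  rewrite diag_mx_sum_delta.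
  elim/big_ind2: _ => [|A k B l leA leB|i _]; first by rewrite mxrank0.
    exact: leq_trans (mxrank_add _ _) (leq_add leA leB).
  have [->|v0] := eqVneq (v ord0 i) 0; first by rewrite scale0r mxrank0.
  by rewrite mxrank_scale_nz // mxrank_delta.
apply/eqP; rewrite eqn_leq le_rank /=.
(* The indicator of the zeros of [u]. The matrix [diag_mx (u + v)] is invertible, so subadditivity
   of the rank turns the upper bound for [v] into the lower bound for [u]. *)
pose v : 'rV[F]_n := \row_i (u ord0 i == 0)%:R.
have uv1 i : u ord0 i + v ord0 i != 0.
  by rewrite !mxE; have [->|u0] := eqVneq (u ord0 i) 0; rewrite ?add0r ?oner_eq0 ?addr0.
have rank_uv : \rank (diag_mx u + diag_mx v)%R = n.
  rewrite -raddfD /=; apply/mxrank_unit; rewrite unitmxE det_diag unitfE.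
  by apply/prodf_neq0 => i _; rewrite mxE.
have sum_n : (\sum_(i < n) (u ord0 i != 0%R) + \sum_(i < n) (v ord0 i != 0%R) = n)%N.
  rewrite -big_split /= -[RHS]card_ord -sum1_card; apply: eq_bigr => i _.
  by rewrite !mxE; case: (u ord0 i == 0%R); rewrite ?oner_eq0 ?eqxx.
rewrite -(leq_add2r (\sum_(i < n) (v ord0 i != 0%R))) sum_n -[leqLHS]rank_uv.
by rewrite (leq_trans (mxrank_add _ _)) // leq_add2l le_rank.
Qed.

Lemma F2_natr_odd (k : nat) : (odd k)%:R = k%:R :> 'F_2.
Proof.
by rewrite -[in RHS](odd_double_half k) natrD -mul2n natrM pchar_Zp // mul0r addr0.
Qed.

(** * Binary symplectic picture of errors and stabilizers *)

Definition symplectic_mx (n : nat) : 'M['F_2]_(n + n) := block_mx 0 1%:M 1%:M 0.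

(** Its row space consists of the binary images of the errors supported on [eps], each erased
    position contributing an X bit and a Z bit. *)
Definition erasure_mx {n : nat} (eps : 'rV['F_2]_n) : 'M['F_2]_(n + n) :=
  diag_mx (row_mx eps eps).

Definition binary_inv {n : nat} (x : 'rV['F_2]_(n + n)) : 'rV[pauli]_n :=
  \row_j bits_pauli (lsubmx x ord0 j, rsubmx x ord0 j).

Lemma binary_invK {n : nat} (x : 'rV['F_2]_(n + n)) :
  binary_mx (binary_inv x) = x.
Proof.
rewrite -[RHS]hsubmxK /binary_mx; congr row_mx; apply/rowP => j;
  by rewrite mxE [binary_inv _ _ _]mxE bits_pauliK.
Qed.

Lemma pauli_bits_inj : injective pauli_bits.
Proof. exact: can_inj pauli_bitsK. Qed.

Lemma binary_mxD (r n : nat) (A B : 'M[pauli]_(r, n)) :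
  binary_mx (A + B) = binary_mx A + binary_mx B.
Proof.
rewrite /binary_mx add_row_mx.
by congr row_mx; apply/matrixP => i j; rewrite !mxE [pauli_bits _]bits_pauliK.
Qed.

Lemma row_binary_mx (r n : nat) (A : 'M[pauli]_(r, n)) i :
  row i (binary_mx A) = binary_mx (row i A).
Proof. by rewrite /binary_mx row_row_mx !map_row. Qed.

Lemma pauli_anticommuteE (a b : pauli) :
  [&& a != b, a != PI & b != PI]%:R =
  (pauli_bits a).2 * (pauli_bits b).1 + (pauli_bits a).1 * (pauli_bits b).2
  :> 'F_2.
Proof. by case: a; case: b; apply/val_inj. Qed.

(** Anticommutation is the symplectic form of the binary images; the syndrome thus becomes a linear
    map, to which rank-nullity applies. *)
Lemma syndromeE (r n : nat) (H : 'M[pauli]_(r, n)) (E : 'rV[pauli]_n) :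
  syndrome H E = binary_mx E *m symplectic_mx n *m (binary_mx H)^T.
Proof.
apply/rowP => i.
rewrite /symplectic_mx mul_row_block tr_row_mx !mulmx0 !mulmx1 add0r addr0.
rewrite mul_row_col !mxE -big_split /= /anticommute F2_natr_odd.
rewrite -sum1dep_card natr_sum big_mkcond /=; apply: eq_bigr => j _.
by rewrite !mxE -pauli_anticommuteE mulrb.
Qed.

(** The operators whose binary image lies in the row space form a group containing every row of [H],
    hence the group they generate. *)
Lemma stab_group_binary (r n : nat) (H : 'M[pauli]_(r, n)) (E : 'rV[pauli]_n) :
  E \in stab_group H -> (binary_mx E <= binary_mx H)%MS.
Proof.
pose G := [set E : 'rV[pauli]_n | (binary_mx E <= binary_mx H)%MS]%SET.
have G_group : group_set G.
  apply/group_setP; split => [|A B]; rewrite !inE.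
    by rewrite (_ : binary_mx 1%g = 0) ?sub0mx //;
       apply: (addrI (binary_mx 0)); rewrite -binary_mxD !addr0.
  by move=> AH BH; rewrite binary_mxD addmx_sub.
suff : (stab_group H \subset Group G_group)%g.
  by move=> /fintype.subsetP sub /sub; rewrite inE.
rewrite gen_subG; apply/fintype.subsetP => _ /imsetP[i _ ->].
by rewrite inE -row_binary_mx row_sub.
Qed.

Lemma binary_mx_erased (n : nat) (eps : 'rV['F_2]_n) (E : 'rV[pauli]_n) :
  (binary_mx E <= erasure_mx eps)%MS -> E \in erased_errors eps.
Proof.
case/submxP => x; rewrite /erasure_mx -[x]hsubmxK diag_mx_row mul_row_block.
rewrite !mulmx0 addr0 add0r => /eq_row_mx[E1 E2].
rewrite inE; apply/forallP => i; apply/implyP => /eqP eps0.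
have := congr1 (fun M : 'rV__ => M ord0 i) E1.
have := congr1 (fun M : 'rV__ => M ord0 i) E2.
rewrite !mul_mx_diag !mxE eps0 !mulr0 => E2i E1i.
by apply/eqP/pauli_bits_inj; rewrite [LHS]surjective_pairing E1i E2i.
Qed.

(** * Bad erasures and the rank bound for good ones *)

Definition logical_error {r n : nat} (H : 'M[pauli]_(r, n)) (eps : 'rV['F_2]_n) : bool :=
  [exists E : 'rV[pauli]_n,
     [&& E \in erased_errors eps, syndrome H E == 0 & E \notin stab_group H]].

Definition weight {n : nat} (eps : 'rV['F_2]_n) : nat :=
  (\sum_(i < n) (eps ord0 i != 0%R))%N.

Lemma mxrank_erasure (n : nat) (eps : 'rV['F_2]_n) :
  \rank (erasure_mx eps) = (weight eps).*2.
Proof. by rewrite /erasure_mx diag_mx_row rank_diag_block_mx mxrank_diag addnn. Qed.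

Lemma erasure_symplecticC (n : nat) (eps : 'rV['F_2]_n) :
  erasure_mx eps *m symplectic_mx n = symplectic_mx n *m erasure_mx eps.
Proof.
rewrite /erasure_mx /symplectic_mx diag_mx_row !mulmx_block.
by rewrite !mulmx0 !mul0mx !mulmx1 !mul1mx !addr0 !add0r.
Qed.

(** Vectors on the left are binary images of zero-syndrome errors supported on [eps]; when [eps] is
    good, all of these are stabilizers. *)
Lemma correctable_in_stab (r n : nat) (H : 'M[pauli]_(r, n)) (eps : 'rV['F_2]_n) :
  ~~ logical_error H eps ->
  (erasure_mx eps :&: kermx (symplectic_mx n *m (binary_mx H)^T)
     <= binary_mx H :&: erasure_mx eps)%MS.
Proof.
move=> nlog; rewrite sub_capmx capmxSl andbT; apply/rV_subP => v.
rewrite sub_capmx -(binary_invK v) => /andP[vD /sub_kermxP vN].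
apply: stab_group_binary; apply/negPn; apply: contra nlog => vS.
apply/existsP; exists (binary_inv v).
by rewrite binary_mx_erased // vS syndromeE -mulmxA vN eqxx.
Qed.

(* Rank-nullity for the syndrome on the erased errors and for the restriction
   of the stabilizer to the erased positions; both maps have the same rank,
   being transposes of each other up to the symplectic form. *)
Lemma mxrank_cap_erasure {r n : nat} {H : 'M[pauli]_(r, n)} {e e' : 'rV['F_2]_n} :
  ~~ logical_error H e -> (forall i, e ord0 i * e' ord0 i = 0) ->
  ((weight e).*2 + \rank (binary_mx H :&: erasure_mx e')%MS
     <= stab_rank H + \rank (binary_mx H :&: erasure_mx e)%MS)%N.
Proof.
move=> nlog ee'0; rewrite -mxrank_erasure /stab_rank.
set M := binary_mx H; set J := symplectic_mx n.
rewrite -(mxrank_mul_ker (erasure_mx e) (J *m M^T)).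
rewrite -(mxrank_mul_ker M (erasure_mx e)) -!addnA leq_add //.
  rewrite mulmxA erasure_symplecticC -mulmxA (leq_trans (mxrankM_maxr _ _)) //.
  by rewrite -mxrank_tr trmx_mul trmxK tr_diag_mx.
rewrite addnC leq_add //; last exact/mxrankS/correctable_in_stab.
(* Stabilizers supported on [e'] are trivial on [e], so the restriction to [e] kills them. *)
apply/mxrankS/capmxS; rewrite ?submx_refl //; apply/sub_kermxP.
rewrite mulmx_diag (_ : \row__ _ = 0) ?raddf0 //.
by apply/rowP => i; rewrite !mxE; case: (fintype.split i) => k; rewrite mulrC ee'0.
Qed.

Lemma disjoint_correctable_weight {r n : nat} {H : 'M[pauli]_(r, n)}
    {e e' : 'rV['F_2]_n} :
  ~~ logical_error H e -> ~~ logical_error H e' ->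
  (forall i, e ord0 i * e' ord0 i = 0) ->
  (weight e + weight e' <= stab_rank H)%N.
Proof.
move=> nlog nlog' ee'0.
have ee'0C i : e' ord0 i * e ord0 i = 0 by rewrite mulrC.
have := mxrank_cap_erasure nlog ee'0.
have := mxrank_cap_erasure nlog' ee'0C.
by rewrite -!mul2n; lia.
Qed.

(** * Bad erasures force decoding errors *)

Lemma erased_errorsD (n : nat) (eps : 'rV['F_2]_n) (E L : 'rV[pauli]_n) :
  L \in erased_errors eps ->
  (E + L \in erased_errors eps) = (E \in erased_errors eps).
Proof.
rewrite !inE => /forallP L0; apply: eq_forallb => i; rewrite mxE.
by have := L0 i; case: (eps ord0 i == 0) => //= /eqP ->; rewrite addr0.
Qed.

Lemma coset_stabD {r n : nat} {H : 'M[pauli]_(r, n)} (E : 'rV[pauli]_n) {L} :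
  L \notin stab_group H ->
  coset (stab_group H) (E + L) != coset (stab_group H) E.
Proof.
have norm (x : 'rV[pauli]_n) : x \in 'N(stab_group H)%g.
  apply: (fintype.subsetP (sub_abelian_norm (FinRing.Theory.zmod_abelian [set: 'rV[pauli]_n]%SET)
    (finset.subsetT _))); exact: finset.in_setT.
(* The sum [E + L] is also the group product of [E] and [L], so the quotient map is multiplicative
   on it. *)
apply: contra => /eqP; rewrite (morphM (coset_morphism _) (norm E) (norm L)).
move=> EL; apply: coset_idr => //.
by apply: (mulgI (coset (stab_group H) E)); rewrite mulg1.
Qed.

(* An undetected logical operator L pairs each error E with E + L, which has the
   same syndrome in another coset, so the decoder is wrong on one of them. *)
Lemma logical_error_half (R : realType) (r n : nat) (H : 'M[pauli]_(r, n))
    (D : decoder H) (eps : 'rV['F_2]_n) :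
  logical_error H eps ->
  1 / 2 <= \sum_(E : 'rV[pauli]_n) error_pr R eps E *
             (D eps (syndrome H E) != coset (stab_group H) E)%:R.
Proof.
case/existsP=> L /and3P[Leps /eqP Lsyn Lstab].
pose f E : R := (D eps (syndrome H E) != coset (stab_group H) E)%:R.
have synL E : syndrome H (E + L) = syndrome H E.
  move: Lsyn; rewrite !syndromeE => Lsyn.
  by rewrite binary_mxD !mulmxDl Lsyn addr0.
have f1 E : 1 <= f E + f (E + L).
  rewrite /f synL; have := coset_stabD E Lstab.
  case: (eqVneq (D eps (syndrome H E))) => [->|_ _]; last by rewrite lerDl ler0n.
  by rewrite eq_sym => ->; rewrite add0r.
have N0 : 0 < #|erased_errors eps|%:R :> R.
  by rewrite ltr0n; apply/card_gt0P; exists L.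
have -> : \sum_(E : 'rV[pauli]_n) error_pr R eps E * f E =
    (#|erased_errors eps|%:R)^-1 * \sum_(E in erased_errors eps) f E.
  rewrite mulr_sumr [RHS]big_mkcond /=; apply: eq_bigr => E _.
  by rewrite /error_pr; case: ifP; rewrite ?mul0r.
(* Translation by [L] permutes the erased errors. *)
have sumL : \sum_(E in erased_errors eps) f (E + L) =
    \sum_(E in erased_errors eps) f E.
  rewrite [RHS](reindex_inj (addIr L)) /=.
  by apply: eq_bigl => E; rewrite erased_errorsD.
have : \sum_(E in erased_errors eps) (1 : R) <=
    \sum_(E in erased_errors eps) (f E + f (E + L)) by apply: ler_sum.
rewrite big_split /= sumL sumr_const => le_sum.
rewrite [leRHS]mulrC ler_pdivlMr //; lra.
Qed.

Definition logical_pr {R : realType} (p : R) {r n : nat} (H : 'M[pauli]_(r, n)) : R :=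
  \sum_(eps : 'rV['F_2]_n) erasure_pr p eps * (logical_error H eps)%:R.

Lemma logical_pr_le (R : realType) (p : R) (r n : nat) (H : 'M[pauli]_(r, n)) :
  0 <= p <= 1 -> logical_pr p H <= 2 * P_err p H.
Proof.
case/andP=> p0 p1; rewrite mulrC -ler_pdivrMr //; apply: lb_le_inf.
  (* A constant decoder shows that the infimum is over a nonempty set. *)
  by exists (decoding_error p ((fun _ _ => 1%g) : decoder H)); exists (fun _ _ => 1%g).
move=> _ [D _ <-]; rewrite /logical_pr mulr_suml; apply: ler_sum => eps _.
under eq_bigr do rewrite -mulrA.
rewrite -mulr_sumr -mulrA ler_wpM2l //.
  by apply: prodr_ge0 => i _; case: ifP => _ //; rewrite subr_ge0.
have [loge|_] := boolP (logical_error H eps); first exact: logical_error_half.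
rewrite mul0r; apply: sumr_ge0 => E _; rewrite mulr_ge0 ?ler0n // /error_pr.
by case: ifP => // _; rewrite invr_ge0 ler0n.
Qed.

(** * Coupling of two disjoint erasures *)

(* Joint law of two disjoint erasures, each of them i.i.d. Bernoulli(p): the
   value Some b puts a position in the erasure b, None in neither. *)
Definition position_pr {R : realType} (p : R) (x : option bool) : R :=
  if x is Some _ then p else 1 - 2 * p.

Definition pair_pr {R : realType} (p : R) {n : nat} (f : {ffun 'I_n -> option bool}) : R :=
  \prod_i position_pr p (f i).

Definition erasure_of {n : nat} (b : bool) (f : {ffun 'I_n -> option bool}) :
    'rV['F_2]_n := \row_i (f i == Some b)%:R.

Lemma big_option_bool (R : realType) (F : option bool -> R) :
  \sum_x F x = F None + F (Some true) + F (Some false).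
Proof.
rewrite (bigD1 None) //= (bigD1 (Some true)) //= (bigD1 (Some false)) //=.
by rewrite big1 ?addr0 ?addrA // => -[[]|].
Qed.

Lemma pair_pr_marginal {R : realType} (p : R) {n : nat} (b : bool)
    (F : 'rV['F_2]_n -> R) :
  \sum_f pair_pr p f * F (erasure_of b f) = \sum_eps erasure_pr p eps * F eps.
Proof.
rewrite (partition_big (erasure_of b) xpredT) //=; apply: eq_bigr => eps _.
under eq_bigr => f /eqP -> do [].
rewrite -mulr_suml; congr (_ * _).
(* Compatibility of the value [x] with [eps] at position [i]. The compatible values have mass [p] at
   an erased position and [p + (1 - 2 * p) = 1 - p] elsewhere. *)
pose Q i x := (x == Some b) == (eps ord0 i == 1).
have -> : erasure_pr p eps = \prod_(i < n) \sum_x (Q i x)%:R * position_pr p x.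
  apply: eq_bigr => i _; rewrite big_option_bool /Q.
  by case: (eps ord0 i == 1); case: b {Q} => /=; lra.
rewrite bigA_distr_bigA big_mkcond /=; apply: eq_bigr => f _.
rewrite big_split /= -/(pair_pr p f).
have F2 (u : 'F_2) (c : bool) : (c%:R == u) = (c == (u == 1)).
  by case: u => [[|[|m]] Hm] //; case: c.
have [eq_eps|neq] := eqVneq (erasure_of b f) eps.
  rewrite big1 ?mul1r // => i _.
  by rewrite /Q -eq_eps mxE -F2 eqxx.
have /existsP[i nQ] : [exists i, ~~ Q i (f i)].
  rewrite -negb_forall; apply: contra neq => /forallP allQ.
  by apply/eqP/rowP => i; apply/eqP; rewrite mxE F2; exact: allQ.
by rewrite (bigD1 i) //= (negbTE nQ) !mul0r.
Qed.

Lemma sum_pair_pr (R : realType) (p : R) (n : nat) :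
  \sum_(f : {ffun 'I_n -> option bool}) pair_pr p f = 1.
Proof.
rewrite -(bigA_distr_bigA (fun _ => position_pr p)) big1 // => i _.
by rewrite big_option_bool /=; lra.
Qed.

Lemma sum_pair_pr_erased (R : realType) (p : R) (n : nat) (i : 'I_n) :
  \sum_f pair_pr p f * (f i != None)%:R = 2 * p.
Proof.
(* The indicator is absorbed into the factor at [i], which then sums to [2 * p]; the other factors
   sum to 1. *)
pose w j x : R := position_pr p x * (if j == i then (x != None)%:R else 1).
transitivity (\prod_j \sum_x w j x).
  rewrite bigA_distr_bigA; apply: eq_bigr => f _; rewrite big_split /=.
  by congr (_ * _); rewrite -big_mkcond big_pred1_eq.
rewrite (bigD1 i) //= [X in _ * X]big1 => [|j /negbTE ji].
  by rewrite big_option_bool /w eqxx /=; lra.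
by rewrite big_option_bool /w ji /=; lra.
Qed.

Lemma weight_erasure_of (n : nat) (f : {ffun 'I_n -> option bool}) :
  (weight (erasure_of true f) + weight (erasure_of false f) =
   \sum_(i < n) (f i != None))%N.
Proof.
rewrite -big_split /=; apply: eq_bigr => i _; rewrite !mxE.
by case: (f i) => [[]|].
Qed.

Lemma erased_count_le {n : nat} (f : {ffun 'I_n -> option bool}) :
  (\sum_(i < n) (f i != None) <= n)%N.
Proof.
by rewrite -[leqRHS]card_ord -sum1_card leq_sum // => i _; case: (f i != None).
Qed.

(** * Bound for a single code *)

Lemma weight_logical_error (R : realType) {r n : nat} (H : 'M[pauli]_(r, n))
    (f : {ffun 'I_n -> option bool}) :
  \sum_(i < n) (f i != None)%:R <= (stab_rank H)%:R
    + n%:R * (logical_error H (erasure_of true f))%:R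
    + n%:R * (logical_error H (erasure_of false f))%:R :> R.
Proof.
rewrite -natr_sum -!natrM -!natrD ler_nat.
have disj i : erasure_of true f ord0 i * erasure_of false f ord0 i = 0.
  by rewrite !mxE; case: (f i) => [[]|]; rewrite ?mulr0 ?mul0r.
have wn := erased_count_le f.
(* A bad erasure contributes [n] on the right, which already dominates the count of erased
   positions; the rank bound serves when both are good. *)
case: (boolP (logical_error H (erasure_of true f))) => [_|c1].
  by rewrite muln1 addnAC (leq_trans wn) // leq_addl.
case: (boolP (logical_error H (erasure_of false f))) => [_|c2].
  by rewrite muln1 (leq_trans wn) // leq_addl.
have := disjoint_correctable_weight c1 c2 disj.
by rewrite weight_erasure_of !muln0 !addn0.
Qed.

(** The constant 4 comes from two marginals, each bad with probability at most [2 * P_err p H]. *)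
Lemma rate_le (R : realType) (p : R) (r n : nat) (H : 'M[pauli]_(r, n)) :
  0 <= p -> p <= 1 / 2 -> (0 < n)%N ->
  rate R H <= 1 - 2 * p + 4 * P_err p H.
Proof.
move=> p0 p1 n0.
(* Here [p <= 1 / 2] makes the weight [1 - 2 * p] of [None] nonnegative. *)
have w0 (f : {ffun 'I_n -> option bool}) : 0 <= pair_pr p f.
  by apply: prodr_ge0 => i _; case: (f i) => [_|] /=; lra.
have : \sum_f pair_pr p f * \sum_(i < n) (f i != None)%:R <= _ :=
  ler_sum _ (fun f _ => ler_wpM2l (w0 f) (weight_logical_error R H f)).
under eq_bigr do rewrite mulr_sumr.
rewrite exchange_big /=; under eq_bigr do rewrite sum_pair_pr_erased.
rewrite sumr_const card_ord.
under eq_bigr do rewrite !mulrDr !(mulrCA _ n%:R).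
rewrite !big_split /= -!mulr_sumr -mulr_suml sum_pair_pr mul1r.
rewrite !(pair_pr_marginal p _ (fun eps => (logical_error H eps)%:R)).
rewrite -/(logical_pr p H) => bound.
have lp : logical_pr p H <= 2 * P_err p H.
  by apply: logical_pr_le; apply/andP; split; lra.
have nR : 0 < n%:R :> R by rewrite ltr0n.
rewrite /rate ler_pdivrMr //.
have := ler_wpM2l (ltW nR) lp; move: bound; rewrite -mulr_natr; nra.
Qed.

(** * Passage to the limit *)

Theorem corollary3p7 (R : realType) (p : R) (hp0 : 0 <= p) (hp1 : p <= 1 / 2)
  (r n : nat -> nat) (hn : forall t, (0 < n t)%N)
  (H : forall t, 'M[pauli]_(r t, n t))
  (hH : forall t, is_stabilizer_matrix (H t))
  (Rlim : R)
  (hR : (fun t => rate R (H t)) @ \oo --> Rlim)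
  (hP : (fun t => P_err p (H t)) @ \oo --> (0 : R)) :
  Rlim <= 1 - 2 * p.
Proof.
have hlim : (fun t => 1 - 2 * p + 4 * P_err p (H t)) @ \oo --> 1 - 2 * p.
  rewrite -[X in _ --> X]addr0 -[X in _ --> _ + X](mulr0 4).
  by apply: cvgD; [exact: cvg_cst | apply: cvgM; [exact: cvg_cst|]].
apply: (ler_cvg_to hR hlim); apply: nearW => t; exact: rate_le.
Qed.
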